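(* Let the polynomials $R_i(x;\boldsymbol\rho)$ and the modified data $(\overline x,\overline{\boldsymbol\rho})$ be chosen such that $\lambda_{x,\boldsymbol\rho}=\zeta\lambda_{\overline x,\overline{\boldsymbol\rho}}-\xi$ for parameters $\zeta,\xi$. Then there are coefficients $\lambda^-_{x,\boldsymbol\rho}$ (independent of $i$) and $\Phi^{\epsilon,-}_i$, $\epsilon\in\{1,0,-1\}$ (independent of $x$), with $\Phi^{-1,-}_0=0$ and $\Phi^{1,-}_0\neq0$, such that $$\lambda^-_{x,\boldsymbol\rho} R_{i}(\overline x;\overline{\boldsymbol\rho})=\Phi_{i}^{-1,-}R_{i-1}(x;\boldsymbol\rho) +\Phi_{i}^{0,-}R_{i}(x;\boldsymbol\rho)+\Phi_{i}^{1,-}R_{i+1}(x;\boldsymbol\rho),\qquad i\ge0,$$ if and only if, up to a global normalization, the coefficients are $$\lambda^-_{x,\boldsymbol\rho}=1+\frac{C_{1,\boldsymbol\rho}}{A_{0,\boldsymbol\rho}-\zeta A_{0,\overline{\boldsymbol\rho}}-\xi}+\frac{\lambda_{x,\boldsymbol\rho}}{A_{0,\boldsymbol\rho}}-\frac{\frac{X_{1,\boldsymbol\rho}}{\zeta Y_{0,\overline{\boldsymbol\rho}}-Y_{0,\boldsymbol\rho}-\xi}-\frac{X_{2,\boldsymbol\rho}-\zeta^2X_{1,\overline{\boldsymbol\rho}}}{\zeta Y_{1,\overline{\boldsymbol\rho}}-Y_{1,\boldsymbol\rho}-\xi}+Y_{1,\boldsymbol\rho}-\zeta Y_{0,\overline{\boldsymbol\rho}}+\xi}{\frac{(A_{0,\boldsymbol\rho}-\zeta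 A_{0,\overline{\boldsymbol\rho}}-\xi)(X_{1,\boldsymbol\rho}-\zeta^2X_{2,\overline{\boldsymbol\rho}})}{C_{1,\boldsymbol\rho}(\zeta Y_{1,\overline{\boldsymbol\rho}}-Y_{1,\boldsymbol\rho}-\xi)}+A_{0,\boldsymbol\rho}},$$ $$\Phi_{i}^{1,-}=\zeta^{-i}\prod_{k=1}^{i}\frac{A_{k,\boldsymbol\rho}}{A_{k-1,\overline{\boldsymbol\rho}}},\qquad i\ge0,$$ $$\Phi_{i}^{-1,-}=\zeta^{i-2}\,\frac{\frac{X_{1,\boldsymbol\rho}}{\zeta Y_{0,\overline{\boldsymbol\rho}}-Y_{0,\boldsymbol\rho}-\xi}-\frac{X_{2,\boldsymbol\rho}-\zeta^2X_{1,\overline{\boldsymbol\rho}}}{\zeta Y_{1,\overline{\boldsymbol\rho}}-Y_{1,\boldsymbol\rho}-\xi}+Y_{1,\boldsymbol\rho}-\zeta Y_{0,\overline{\boldsymbol\rho}}+\xi}{A_{0,\overline{\boldsymbol\rho}}A_{0,\boldsymbol\rho}\left(\frac{X_{1,\boldsymbol\rho}-\zeta^2X_{2,\overline{\boldsymbol\rho}}}{X_{1,\boldsymbol\rho}(\zeta Y_{1,\overline{\boldsymbol\rho}}-Y_{1,\boldsymbol\rho}-\xi)}+\frac{1}{\zeta Y_{0,\overline{\boldsymbol\rho}}-Y_{0,\boldsymbol\rho}-\xi}\right)}\prod_{k=1}^{i-1}\frac{C_{k+1,\overline{\boldsymbol\rho}}}{C_{k,\boldsymbol\rho}},\qquad i\ge1,$$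 $$\Phi_{i}^{0,-}=\frac{X_{i+1,\boldsymbol\rho}-\zeta^2X_{i,\overline{\boldsymbol\rho}}}{A_{i,\boldsymbol\rho}(\zeta Y_{i,\overline{\boldsymbol\rho}}-Y_{i,\boldsymbol\rho}-\xi)}\Phi^{1,-}_{i}+\frac{X_{i,\boldsymbol\rho}-\zeta^2X_{i+1,\overline{\boldsymbol\rho}}}{\zeta C_{i+1,\overline{\boldsymbol\rho}}(\zeta Y_{i,\overline{\boldsymbol\rho}}-Y_{i,\boldsymbol\rho}-\xi)}\Phi^{-1,-}_{i+1},\qquad i\ge0,$$ and the constraints $(\mathfrak C_{B_2})$ are satisfied.
   Context: $R_i(x;\boldsymbol\rho)$, $i=0,1,\dots,N$, denotes the polynomials of a finite family of the ($q$-)Askey scheme; $\boldsymbol\rho$ is the list of parameters, which includes the non-negative integer $N$. $R_i(x;\boldsymbol\rho)$ is a polynomial of degree $i$ in the variable $\lambda_{x,\boldsymbol\rho}$, normalized by $R_0(x;\boldsymbol\rho)=R_i(0;\boldsymbol\rho)=1$, and satisfies $$\lambda_{x,\boldsymbol\rho}R_i(x;\boldsymbol\rho)=A_{i,\boldsymbol\rho}R_{i+1}(x;\boldsymbol\rho)-(A_{i,\boldsymbol\rho}+C_{i,\boldsymbol\rho})R_i(x;\boldsymbol\rho)+C_{i,\boldsymbol\rho}R_{i-1}(x;\boldsymbol\rho),\qquad C_{0,\boldsymbol\rho}=0,\ A_{N,\boldsymbol\rho}=0.$$ $\overline{\boldsymbol\rho}$ is a list of modified parameters (of the same family) and $\overline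 x=x+\eta$ with $\eta\in\{0,+1,-1\}$. Notation: $X_{i,\boldsymbol\rho}:=A_{i-1,\boldsymbol\rho}C_{i,\boldsymbol\rho}$, $Y_{i,\boldsymbol\rho}:=-(A_{i,\boldsymbol\rho}+C_{i,\boldsymbol\rho})$, with $X_{0,\boldsymbol\rho}=0$. Parameters are generic, so that the denominators which occur do not vanish. The constraints $(\mathfrak C_{B_2})$: the two expressions $$\zeta^{2i}\frac{\frac{\zeta^2X_{i+1,\overline{\boldsymbol\rho}}-X_{i,\boldsymbol\rho}}{\xi+Y_{i,\boldsymbol\rho}-\zeta Y_{i,\overline{\boldsymbol\rho}}}-\frac{\zeta^2X_{i+2,\overline{\boldsymbol\rho}}-X_{i+1,\boldsymbol\rho}}{\xi+Y_{i+1,\boldsymbol\rho}-\zeta Y_{i+1,\overline{\boldsymbol\rho}}}+\zeta Y_{i+1,\overline{\boldsymbol\rho}}-Y_{i,\boldsymbol\rho}-\xi}{\frac{X_{i+1,\boldsymbol\rho}}{\zeta^2X_{i+1,\overline{\boldsymbol\rho}}}\frac{\zeta^2X_{i+1,\overline{\boldsymbol\rho}}-X_{i+2,\boldsymbol\rho}}{\xi+Y_{i+1,\boldsymbol\rho}-\zeta Y_{i+1,\overline{\boldsymbol\rho}}}-\frac{\zeta^2X_{i,\overline{\boldsymbol\rho}}-X_{i+1,\boldsymbol\rho}}{\xi+Y_{i,\boldsymbol\rho}-\zeta Y_{i,\overline{\boldsymbol\rho}}}}\prod_{k=1}^{i}\frac{X_{k,\overline{\boldsymbol\rho}}}{X_{k,\boldsymbol\rho}},$$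 $$\zeta^{2i}\frac{\frac{\zeta^2X_{i+1,\overline{\boldsymbol\rho}}-X_{i,\boldsymbol\rho}}{\xi+Y_{i,\boldsymbol\rho}-\zeta Y_{i,\overline{\boldsymbol\rho}}}-\frac{\zeta^2X_{i+1,\overline{\boldsymbol\rho}}}{X_{i+1,\boldsymbol\rho}}\frac{\zeta^2X_{i+2,\overline{\boldsymbol\rho}}-X_{i+1,\boldsymbol\rho}}{\xi+Y_{i+1,\boldsymbol\rho}-\zeta Y_{i+1,\overline{\boldsymbol\rho}}}}{\frac{\zeta^2X_{i+1,\overline{\boldsymbol\rho}}-X_{i+2,\boldsymbol\rho}}{\xi+Y_{i+1,\boldsymbol\rho}-\zeta Y_{i+1,\overline{\boldsymbol\rho}}}-\frac{\zeta^2X_{i,\overline{\boldsymbol\rho}}-X_{i+1,\boldsymbol\rho}}{\xi+Y_{i,\boldsymbol\rho}-\zeta Y_{i,\overline{\boldsymbol\rho}}}+\zeta Y_{i,\overline{\boldsymbol\rho}}-Y_{i+1,\boldsymbol\rho}-\xi}\prod_{k=1}^{i}\frac{X_{k,\overline{\boldsymbol\rho}}}{X_{k,\boldsymbol\rho}}$$ are equal and independent of $i$ for $i\ge0$.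
   Formalization: The formal theorem also assumes that the sizes N of the two families differ by at most 1, and requires the coefficient λ⁻ to vanish at grid points x for which the shifted point lies off the grid of the modified family; without these the equivalence fails. *)

(* Defs.v *)
From HB Require Import structures.
From mathcomp Require Import all_boot all_order all_algebra.

Set Implicit Arguments.
Unset Strict Implicit.
Unset Printing Implicit Defensive.

Import Order.TTheory GRing.Theory Num.Theory.
Local Open Scope ring_scope.

(* R_i(x; rho) = (pol i).[lam x], at a fixed value of the parameters rho; the
   modified parameters give a second record.  The variable x is an integer
   because x + eta may leave the grid {0, .., top}.  Since cA top = 0, the
   recurrence at i = top says that R_top satisfies a polynomial equation of
   degree top + 1 in lam x, which only holds on the grid; below top, the
   recurrence on the top + 1 grid points is equivalent to the identity of
   polynomials.  The values of pol, cA and cC beyond top are irrelevant. *)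
Record finite_family (F : fieldType) := FiniteFamily {
  top : nat;
  lam : int -> F;
  pol : nat -> {poly F};
  cA : nat -> F;
  cC : nat -> F;
  lam_grid_inj : forall x y : nat, (x <= top)%N -> (y <= top)%N ->
    lam x%:Z = lam y%:Z -> x = y;
  pol_size : forall i, (i <= top)%N -> size (pol i) = i.+1;
  pol_0 : pol 0%N = 1;
  pol_at_0 : forall i, (i <= top)%N -> (pol i).[lam 0] = 1;
  cC_0 : cC 0%N = 0;
  cA_top : cA top = 0;
  recurrence : forall i x : nat, (i <= top)%N -> (x <= top)%N ->
    lam x%:Z * (pol i).[lam x%:Z] =
      cA i * (pol i.+1).[lam x%:Z] - (cA i + cC i) * (pol i).[lam x%:Z]
      + cC i * (pol i.-1).[lam x%:Z]
}.

(* R_i for i > top does not belong to the family, and terms containing it are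
   absent from the relations. *)
Definition R (F : fieldType) (rho : finite_family F) (i : nat) (x : int) : F :=
  if (i <= top rho)%N then (pol rho i).[lam rho x] else 0.

Section Coefficients.

Variables (F : fieldType) (rho rhob : finite_family F) (z xi : F).

Definition X (r : finite_family F) (i : nat) : F :=
  if i is j.+1 then cA r j * cC r j.+1 else 0.

Definition Y (r : finite_family F) (i : nat) : F := - (cA r i + cC r i).

Definition D (i : nat) : F := xi + Y rho i - z * Y rhob i.

Definition E (i : nat) : F := z * Y rhob i - Y rho i - xi.

Definition num1 (i : nat) : F :=
  (z ^+ 2 * X rhob i.+1 - X rho i) / D i
  - (z ^+ 2 * X rhob i.+2 - X rho i.+1) / D i.+1
  + z * Y rhob i.+1 - Y rho i - xi.

Definition den1 (i : nat) : F :=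
  X rho i.+1 / (z ^+ 2 * X rhob i.+1)
    * ((z ^+ 2 * X rhob i.+1 - X rho i.+2) / D i.+1)
  - (z ^+ 2 * X rhob i - X rho i.+1) / D i.

Definition num2 (i : nat) : F :=
  (z ^+ 2 * X rhob i.+1 - X rho i) / D i
  - z ^+ 2 * X rhob i.+1 / X rho i.+1
    * ((z ^+ 2 * X rhob i.+2 - X rho i.+1) / D i.+1).

Definition den2 (i : nat) : F :=
  (z ^+ 2 * X rhob i.+1 - X rho i.+2) / D i.+1
  - (z ^+ 2 * X rhob i - X rho i.+1) / D i
  + z * Y rhob i - Y rho i.+1 - xi.

Definition expr1 (i : nat) : F :=
  z ^+ (2 * i) * (num1 i / den1 i)
  * \prod_(1 <= k < i.+1) (X rhob k / X rho k).

Definition expr2 (i : nat) : F :=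
  z ^+ (2 * i) * (num2 i / den2 i)
  * \prod_(1 <= k < i.+1) (X rhob k / X rho k).

Definition bound : nat := minn (top rho) (top rhob).

(* X_{i+1,rho} and X_{i+1,rhob} are denominators, and they vanish at
   i + 1 = top rho + 1, resp. i + 1 = top rhob + 1: i < bound is the range in
   which the two expressions are defined. *)
Definition C_B2 : Prop :=
  exists K : F, forall i, (i < bound)%N -> expr1 i = K /\ expr2 i = K.

Definition numB : F :=
  X rho 1 / E 0 - (X rho 2 - z ^+ 2 * X rhob 1) / E 1
  + Y rho 1 - z * Y rhob 0 + xi.

Definition denB : F :=
  (X rho 1 - z ^+ 2 * X rhob 2) / (X rho 1 * E 1) + 1 / E 0.

Definition lamM (x : int) : F :=
  1 + cC rho 1 / (cA rho 0 - z * cA rhob 0 - xi) + lam rho x / cA rho 0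
  - numB / ((cA rho 0 - z * cA rhob 0 - xi) * (X rho 1 - z ^+ 2 * X rhob 2)
              / (cC rho 1 * E 1)
            + cA rho 0).

Definition PhiP (i : nat) : F :=
  z ^- i * \prod_(1 <= k < i.+1) (cA rho k / cA rhob k.-1).

Definition PhiM (i : nat) : F :=
  if i is 0%N then 0 else
  z ^ (i%:Z - 2) * (numB / (cA rhob 0 * cA rho 0 * denB))
  * \prod_(1 <= k < i) (cC rhob k.+1 / cC rho k).

(* PhiP i / cA rho i and PhiM i.+1 / cC rhob i.+1, with the common factor
   cancelled.  They are needed in this form in Phi0 at the two ends
   i = top rho, where PhiP i = cA rho i = 0, and i = top rhob, where
   cC rhob i.+1 is not a coefficient of the family. *)
Definition PhiP_div_A (i : nat) : F :=
  z ^- i * (cA rho 0)^-1 * \prod_(1 <= k < i.+1) (cA rho k.-1 / cA rhob k.-1).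

Definition PhiM_div_C (i : nat) : F :=
  z ^ (i%:Z - 1) * (numB / (cA rhob 0 * cA rho 0 * denB)) * (cC rhob 1)^-1
  * \prod_(1 <= k < i.+1) (cC rhob k / cC rho k).

Definition Phi0 (i : nat) : F :=
  (X rho i.+1 - z ^+ 2 * X rhob i) / E i * PhiP_div_A i
  + (X rho i - z ^+ 2 * X rhob i.+1) / (z * E i) * PhiM_div_C i.

Lemma PhiP_div_AE (i : nat) :
  cA rho 0 != 0 -> cA rho i != 0 -> PhiP_div_A i = PhiP i / cA rho i.
Proof.
move=> A0 Ai; rewrite /PhiP_div_A /PhiP -!mulrA; congr (_ * _).
rewrite !prodf_div [RHS]mulrAC mulrA; congr (_ / _).
apply: (mulfI A0); rewrite mulVKf //; apply: (mulIf Ai).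
rewrite mulrA mulfVK // !big_add1 -[LHS](big_nat_recr i 0 (cA rho)) //=.
by rewrite big_nat_recl.
Qed.

Lemma PhiM_div_CE (i : nat) :
  cC rhob 1 != 0 -> cC rhob i.+1 != 0 ->
  PhiM_div_C i = PhiM i.+1 / cC rhob i.+1.
Proof.
move=> C1 Ci; rewrite /PhiM_div_C /PhiM.
have -> : i.+1%:Z - 2 = i%:Z - 1 by rewrite -addn1 PoszD -addrA.
rewrite -!mulrA; do 3 congr (_ * _).
rewrite !prodf_div [RHS]mulrAC mulrA; congr (_ / _).
apply: (mulfI C1); rewrite mulVKf //; apply: (mulIf Ci).
rewrite mulrA mulfVK // -[LHS](big_nat_recr i.+1 1 (cC rhob)) //=.
by rewrite big_nat_recl // big_add1.
Qed.

Lemma Phi0E (i : nat) :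
  cA rho 0 != 0 -> cA rho i != 0 -> cC rhob 1 != 0 -> cC rhob i.+1 != 0 ->
  Phi0 i =
    (X rho i.+1 - z ^+ 2 * X rhob i) / (cA rho i * E i) * PhiP i
    + (X rho i - z ^+ 2 * X rhob i.+1) / (z * cC rhob i.+1 * E i) * PhiM i.+1.
Proof.
move=> A0 Ai C1 Ci; rewrite /Phi0 PhiP_div_AE // PhiM_div_CE //.
move: (PhiP i) (PhiM i.+1) => p m; rewrite !invfM -!mulrA.
congr (_ * _ + _ * (_ * _)).
  by rewrite mulrCA mulrA mulrC [p / _]mulrC mulrCA mulrA.
by rewrite mulrCA mulrA mulrC [m / _]mulrC mulrCA mulrA.
Qed.

(* The denominators that occur do not vanish.  The first two conditions say
   that the denominators cA rho 0 and cA rhob 0 are not the vanishing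
   coefficients cA (top _).  The last denominator of lamM is
   cA rho 0 * E 0 * denB. *)
Record generic : Prop := Generic {
  gen_top : (0 < top rho)%N;
  gen_topb : (0 < top rhob)%N;
  gen_A : forall i, (i < top rho)%N -> cA rho i != 0;
  gen_Ab : forall i, (i < top rhob)%N -> cA rhob i != 0;
  gen_C : forall i, (0 < i <= top rho)%N -> cC rho i != 0;
  gen_Cb : forall i, (0 < i <= top rhob)%N -> cC rhob i != 0;
  gen_z : z != 0;
  gen_D : forall i, (i <= bound)%N -> D i != 0;
  gen_den1 : forall i, (i < bound)%N -> den1 i != 0;
  gen_den2 : forall i, (i < bound)%N -> den2 i != 0;
  gen_denB : denB != 0
}.

Variable eta : int.

(* The last condition of the modification restricts the change of the
   parameter N.  Without it no relation with Phi^1_0 != 0 can hold: for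
   top rhob < top rho - 1, lm would be of degree 1 in lam rho x and vanish at
   two grid points, and for top rhob > top rho + 1 the right-hand side is
   empty for i >= top rho + 2, which forces lm = 0. *)
Definition modification : Prop :=
  [/\ eta \in [:: 0; 1; -1],
      forall x : nat, (x <= top rho)%N ->
        lam rho x%:Z = z * lam rhob (x%:Z + eta) - xi
    & (top rhob <= (top rho).+1)%N /\ (top rho <= (top rhob).+1)%N].

(* Relation between functions on the grid {0, .., top rho}.  At a point x for
   which x + eta falls outside the grid of rhob, R_i(x + eta; rhob) is not a
   value of the family rhob, and the left-hand side has to vanish.  Two points
   of the variable are distinguished by the value of lam rhob. *)
Definition contiguity (lm : int -> F) (Pm P0 Pp : nat -> F) : Prop :=
  [/\ Pm 0%N = 0, Pp 0%N != 0,
      forall x : nat, (x <= top rho)%N ->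
        (forall y : nat, (y <= top rhob)%N ->
           lam rhob (x%:Z + eta) != lam rhob y%:Z) ->
        lm x%:Z = 0
    & forall i x : nat, (i <= top rhob)%N -> (x <= top rho)%N ->
        lm x%:Z * R rhob i (x%:Z + eta) =
          Pm i * R rho i.-1 x%:Z + P0 i * R rho i x%:Z + Pp i * R rho i.+1 x%:Z].

(* Only the coefficients in front of members R_0, .., R_(top rho) of the
   family are compared. *)
Definition explicit_coefficients (lm : int -> F) (Pm P0 Pp : nat -> F) : Prop :=
  exists2 c : F, c != 0 &
    [/\ forall x : nat, (x <= top rho)%N -> lm x%:Z = c * lamM x%:Z,
        forall i, (i <= top rhob)%N -> (i.+1 <= top rho)%N ->
          Pp i = c * PhiP i,
        forall i, (i <= top rhob)%N -> (i.-1 <= top rho)%N ->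
          Pm i = c * PhiM i
      & forall i, (i <= top rhob)%N -> (i <= top rho)%N ->
          P0 i = c * Phi0 i].

End Coefficients.

(* Main.v *)
Require Import Defs.
From HB Require Import structures.
From mathcomp Require Import all_boot all_order all_algebra.
From mathcomp Require Import ring zify.
Set Implicit Arguments.
Unset Strict Implicit.
Unset Printing Implicit Defensive.
Import Order.TTheory GRing.Theory Num.Theory.
Local Open Scope ring_scope.

(** Let N and M be the tops of rho and rhob, and work with functions on the grid
    {0, .., N} of rho, of which R_0, .., R_N is a basis.  There, multiplication
    by lam rho + xi = z * lam rhob (. + eta) acts by a three-term recurrence
    both on the R_j and on the shifted R_i of rhob.  Applying it to both sides
    of the contiguity relation at i and comparing the coefficients of
    R_(i-2), .., R_(i+2) ([residue_eq0]) turns the contiguity into five scalar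
    recurrences for the coefficients Phi.

    The coefficients of R_(i+2) and R_(i-2) determine Phi^1 and Phi^-1 up to two
    constants c and mu ([shapeP], [shapeM]).  The coefficient of R_i gives Phi^0
    ([cR0_shape]).  The coefficients of R_(i+1) and R_(i-1) then become
      num2 i * (mu * weightM i) = den2 i * (z * PhiP_div_A i),
      num1 i * (mu * weightM i) = den1 i * (z * PhiP_div_A i),
    ([cRp1_shape], [cRm1_shape]), which say that num1 / den1 and num2 / den2
    are the same explicit multiple of 1 / mu.  This is the constraint C_B2,
    and the case i = 0 fixes mu ([C_B2_ratio]); here denB != 0 rules out the
    value 0 of the constant in C_B2, for which there is no mu.

    Conversely, the scalar recurrences for i < M give the contiguity relations
    by induction on i, because A_(i, rhob) != 0 there.  At i = M the recurrence
    for rhob holds only on its own grid, and the relation says exactly that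
    lm vanishes at the points leaving that grid.  When N and M differ,
    one of the scalar recurrences at i = M is not a consequence of C_B2 in an
    obvious way, but the residue is then a multiple of R_N, which vanishes
    nowhere on the grid ([R_top_neq0]); evaluating at a point that stays in the
    grid of rhob shows that it is 0 ([system_contiguity]). *)

(** * One family: the grid and the recurrence *)

Section OneFamily.

Variables (F : fieldType) (r : finite_family F).

(** The values of the variable of the polynomials on the grid 0, .., top. *)
Definition grid : seq F := [seq lam r x%:Z | x : nat <- iota 0 (top r).+1].

Lemma gridP (t : F) :
  reflect (exists2 y : nat, (y <= top r)%N & t = lam r y%:Z) (t \in grid).
Proof.
apply: (iffP mapP) => -[y yin ->]; exists y => //.
  by move: yin; rewrite mem_iota add0n ltnS.
by rewrite mem_iota add0n ltnS.
Qed.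

Lemma size_grid : size grid = (top r).+1.
Proof. by rewrite size_map size_iota. Qed.

Lemma grid_uniq : uniq grid.
Proof.
rewrite map_inj_in_uniq ?iota_uniq // => x y.
by rewrite !mem_iota !add0n !ltnS /=; apply: lam_grid_inj.
Qed.

Lemma grid_poly_eq0 (P : {poly F}) :
  (size P <= (top r).+1)%N ->
  (forall x : nat, (x <= top r)%N -> P.[lam r x%:Z] = 0) -> P = 0.
Proof.
move=> szP P0; apply/eqP; apply: contraTT szP => nzP; rewrite -ltnNge -size_grid.
apply: max_poly_roots => //; last exact: grid_uniq.
by apply/allP => _ /gridP[x lex ->]; apply/rootP/P0.
Qed.

(** The polynomial in the variable lam whose vanishing is the recurrence at
    index i.  It is 0 for i < top, and has exactly the grid as its set of roots
    for i = top. *)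
Definition recurrence_defect (i : nat) : {poly F} :=
  'X * pol r i - (cA r i *: pol r i.+1 - (cA r i + cC r i) *: pol r i
                  + cC r i *: pol r i.-1).

Lemma recurrence_defectE (i : nat) (t : F) :
  (recurrence_defect i).[t] =
  t * (pol r i).[t] - (cA r i * (pol r i.+1).[t]
     - (cA r i + cC r i) * (pol r i).[t] + cC r i * (pol r i.-1).[t]).
Proof. by rewrite !hornerE. Qed.

Lemma recurrence_defect_grid (i x : nat) : (i <= top r)%N -> (x <= top r)%N ->
  (recurrence_defect i).[lam r x%:Z] = 0.
Proof. by move=> lei lex; rewrite recurrence_defectE recurrence // subrr. Qed.

Lemma size_pol_le (i j : nat) : (i <= top r)%N -> (i < j)%N ->
  (size (pol r i) <= j)%N.
Proof. by move=> lei; rewrite pol_size. Qed.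

Lemma recurrence_defect_eq0 (i : nat) : (i < top r)%N ->
  recurrence_defect i = 0.
Proof.
move=> lti; apply: grid_poly_eq0 => [|x lex]; last first.
  by apply: recurrence_defect_grid => //; apply: ltnW.
apply: leq_trans (size_polyD _ _) _; rewrite size_polyN geq_max.
apply/andP; split.
  by apply: leq_trans (size_polyMleq _ _) _; rewrite size_polyX pol_size; lia.
apply: leq_trans (size_polyD _ _) _; rewrite geq_max.
apply/andP; split; last first.
  by apply: leq_trans (size_scale_leq _ _) _; apply: size_pol_le; lia.
apply: leq_trans (size_polyD _ _) _; rewrite size_polyN geq_max.
by apply/andP; split; apply: leq_trans (size_scale_leq _ _) _;
  apply: size_pol_le; lia.
Qed.

Lemma recurrence_defect_top (t : F) :
  ((recurrence_defect (top r)).[t] == 0) = (t \in grid).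
Proof.
apply/eqP/gridP => [|[y ley ->]]; last exact: recurrence_defect_grid.
set P := recurrence_defect _ => Pt0.
have szP : size P = (top r).+2.
  rewrite /P /recurrence_defect cA_top scale0r sub0r.
  rewrite size_polyDl; rewrite mulrC size_mulX -?size_poly_eq0 pol_size //.
  rewrite size_polyN; apply: leq_ltn_trans (size_polyD _ _) _; rewrite gtn_max.
  rewrite size_polyN; apply/andP; split;
    apply: leq_ltn_trans (size_scale_leq _ _) _;
    rewrite ltnS; apply: size_pol_le; lia.
have nzP : P != 0 by rewrite -size_poly_eq0 szP.
apply/gridP; apply: contraT => off.
have uniq_tg : uniq (t :: grid) by rewrite cons_uniq off grid_uniq.
have roots_tg : all (root P) (t :: grid).
  apply/allP => u; rewrite in_cons => /predU1P[-> | /gridP[x lex ->]].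
    exact/rootP.
  exact/rootP/recurrence_defect_grid.
have := max_poly_roots nzP roots_tg uniq_tg.
by rewrite szP -[size _]/(size grid).+1 size_grid ltnn.
Qed.

Lemma R_defect (i : nat) (y : int) : (i <= top r)%N ->
  lam r y * R r i y
    - (cA r i * R r i.+1 y + Y r i * R r i y + cC r i * R r i.-1 y) =
  (recurrence_defect i).[lam r y].
Proof.
move=> lei; rewrite recurrence_defectE /R /Y lei (leq_trans (leq_pred i) lei).
rewrite mulNr; move: lei; rewrite leq_eqVlt => /predU1P[->|->] //.
by rewrite cA_top !mul0r.
Qed.

(** The coefficient cC, set to 0 beyond the top.  Since R_i = 0 for i > top,
    the recurrence then holds on the grid for all i. *)
Definition cCt (i : nat) : F := if (i <= top r)%N then cC r i else 0.

Lemma R_recurrence (i x : nat) : (x <= top r)%N ->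
  lam r x%:Z * R r i x%:Z =
  cA r i * R r i.+1 x%:Z + Y r i * R r i x%:Z + cCt i * R r i.-1 x%:Z.
Proof.
move=> lex; rewrite /R /cCt /Y; have [lti|gti|->] := ltngtP i (top r).
- by rewrite (leq_trans (leq_pred i) (ltnW lti)) recurrence ?mulNr // ltnW.
- by rewrite !mulr0 mul0r !addr0.
- by rewrite leq_pred recurrence // cA_top !mul0r mulNr.
Qed.

(** If R_top vanished at a grid point, the recurrence, run downwards from the
    top, would give R_0 = 0 there. *)
Lemma R_top_neq0 (x : nat) : (x <= top r)%N ->
  (forall i, (0 < i <= top r)%N -> cC r i != 0) -> R r (top r) x%:Z != 0.
Proof.
move=> lex nzC; apply/negP => /eqP Rtop.
have R0 i : (i <= top r)%N ->
    R r (top r - i)%N x%:Z = 0 /\ R r (top r - i).+1 x%:Z = 0.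
  elim: i => [|i IHi] lti; first by rewrite subn0 /R ltnn.
  have [Ri RSi] := IHi (ltnW lti); rewrite -subSn // subSS; split=> //.
  have := R_recurrence (top r - i)%N lex.
  rewrite Ri RSi !mulr0 !add0r /cCt leq_subr => /esym/eqP.
  rewrite mulf_eq0 (negPf (nzC _ _)) /=; last by rewrite leq_subr; lia.
  by rewrite -subnS => /eqP.
have [/eqP + _] := R0 _ (leqnn _).
by rewrite subnn /R leq0n pol_0 hornerC oner_eq0.
Qed.

(** Linear independence of R_0, .., R_top on the grid, for a linear combination
    given as a list of coefficients and indices; indices may be repeated or
    exceed the top. *)
Lemma R_free_seq (s : seq (F * nat)) :
  (forall x : nat, (x <= top r)%N -> \sum_(p <- s) p.1 * R r p.2 x%:Z = 0) ->
  forall j : nat, (j <= top r)%N -> \sum_(p <- s | p.2 == j) p.1 = 0.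
Proof.
pose f j := \sum_(p <- s | p.2 == j) p.1.
move=> s0.
have fn0 n : (n <= (top r).+1)%N -> \sum_(j < n) f j *: pol r j = 0 ->
    forall j, (j < n)%N -> f j = 0.
  elim: n => // n IHn len; rewrite big_ord_recr /= => sum0.
  have fn : f n = 0.
    have := congr1 (fun P : {poly F} => P`_n) sum0.
    rewrite coefD coef0 coefZ nth_default ?add0r; last first.
      apply: leq_trans (size_sum _ _ _) _; apply/bigmax_leqP => j _.
      apply: leq_trans (size_scale_leq _ _) _.
      by rewrite pol_size //; have := ltn_ord j; lia.
    have <- : lead_coef (pol r n) = (pol r n)`_n by rewrite lead_coefE pol_size.
    move/eqP; rewrite mulf_eq0 lead_coef_eq0 -size_poly_eq0.
    by rewrite pol_size // orbF => /eqP.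
  move: sum0; rewrite fn scale0r addr0 => /IHn{}IHn j.
  by rewrite ltnS leq_eqVlt => /predU1P[->//|]; apply: IHn; lia.
move=> j lej; apply: (fn0 (top r).+1) => //.
apply: grid_poly_eq0 => [|x lex].
  apply: leq_trans (size_sum _ _ _) _; apply/bigmax_leqP => i _.
  apply: leq_trans (size_scale_leq _ _) _.
  by rewrite pol_size // -ltnS.
rewrite horner_sum -[RHS](s0 x lex).
under eq_bigr => i _ do rewrite hornerZ /f mulr_suml big_mkcond.
rewrite exchange_big /=; apply: eq_bigr => p _; rewrite -big_mkcond /R /=.
case: leqP => lep.
  by rewrite (big_pred1 (Ordinal (lep : (p.2 < (top r).+1)%N))).
rewrite mulr0 big1 // => i /eqP ei; have := ltn_ord i.
by rewrite -ei ltnS leqNgt lep.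
Qed.

End OneFamily.

(** * Contiguity relations as scalar recurrences *)

Section TwoFamilies.

Variables (F : fieldType) (rho rhob : finite_family F) (z xi : F).

Section Coefficients.

Variables Pm P0 Pp : nat -> F.

(** The right-hand side of the contiguity relation at i. *)
Definition combination (i : nat) (x : int) : F :=
  Pm i * R rho i.-1 x + P0 i * R rho i x + Pp i * R rho i.+1 x.

Lemma cCt_0 : cCt rho 0 = 0.
Proof. by rewrite /cCt cC_0. Qed.

(** The coefficients of R_(i+2), R_(i+1), R_i, R_(i-1) and R_(i-2) that
    remain when the three-term recurrences are applied to both sides of the
    contiguity relation at i. *)
Definition cRp2 (i : nat) : F :=
  Pp i * cA rho i.+1 - z * cA rhob i * Pp i.+1.

Definition cRp1 (i : nat) : F :=
  P0 i * cA rho i - z * cA rhob i * P0 i.+1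
  - (z * Y rhob i - Y rho i.+1 - xi) * Pp i.

Definition cR0 (i : nat) : F :=
  Pp i * cCt rho i.+1 + Pm i * cA rho i.-1 - z * cA rhob i * Pm i.+1
  - z * cC rhob i * Pp i.-1 - E rho rhob z xi i * P0 i.

Definition cRm1 (i : nat) : F :=
  P0 i * cCt rho i - z * cC rhob i * P0 i.-1
  - (z * Y rhob i - Y rho i.-1 - xi) * Pm i.

Definition cRm2 (i : nat) : F :=
  Pm i * cCt rho i.-1 - z * cC rhob i * Pm i.-1.

(** For i < 2 the truncated indices i.-1 and i.-2 may coincide with others; if
    Pm 0 = 0, the coefficients of the terms that should be absent are 0. *)
Definition residue (i : nat) (x : int) : F :=
  cRm2 i * R rho i.-2 x + cRm1 i * R rho i.-1 x + cR0 i * R rho i x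
  + cRp1 i * R rho i.+1 x + cRp2 i * R rho i.+2 x.

Lemma residueE (i x : nat) : Pm 0 = 0 -> (x <= top rho)%N ->
  residue i x%:Z =
  (lam rho x%:Z + xi) * combination i x%:Z
  - z * (cA rhob i * combination i.+1 x%:Z + Y rhob i * combination i x%:Z
         + cC rhob i * combination i.-1 x%:Z).
Proof.
move=> Pm0 lex.
have rec j := R_recurrence j lex.
have mulC a u b v c w : lam rho x * (a * u + b * v + c * w) =
  a * (lam rho x * u) + b * (lam rho x * v) + c * (lam rho x * w) by ring.
rewrite /combination (mulrDl (lam rho x%:Z)) mulC !rec.
rewrite /residue /cRm2 /cRm1 /cR0 /cRp1 /cRp2 /E.
case: i => [|i] /=; last by ring.
by rewrite Pm0 cC_0 cCt_0; ring.
Qed.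

(** The scalar recurrences at i: the coefficients in [residue] vanish, as far as
    they stand in front of members of the family. *)
Definition R_system (i : nat) : Prop :=
  [/\ (1 < i)%N -> (i.-2 <= top rho)%N -> cRm2 i = 0,
      (0 < i)%N -> (i.-1 <= top rho)%N -> cRm1 i = 0,
      (i <= top rho)%N -> cR0 i = 0,
      (i.+1 <= top rho)%N -> cRp1 i = 0 &
      (i.+2 <= top rho)%N -> cRp2 i = 0].

Lemma cRm2_0 : Pm 0 = 0 -> cRm2 0 = 0.
Proof. by move=> Pm0; rewrite /cRm2 Pm0 cC_0 mulr0 !mul0r subr0. Qed.

Lemma cRm2_1 : Pm 0 = 0 -> cRm2 1 = 0.
Proof.
by move=> Pm0; rewrite /cRm2 /= Pm0 cCt_0 !mulr0 subr0.
Qed.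

Lemma cRm1_0 : Pm 0 = 0 -> cRm1 0 = 0.
Proof.
by move=> Pm0; rewrite /cRm1 Pm0 cCt_0 cC_0 !mulr0 !mul0r !subr0.
Qed.

Lemma residue_eq0 (i : nat) : Pm 0 = 0 -> 
  R_system i <-> (forall x : nat, (x <= top rho)%N -> residue i x%:Z = 0).
Proof.
move=> Pm0; split.
  case=> em ed ec eb ea x lex; rewrite /residue.
  have term0 (a : F) j : ((j <= top rho)%N -> a = 0) -> a * R rho j x%:Z = 0.
    by rewrite /R; case: leqP => [_ -> //|_ _]; rewrite ?mul0r ?mulr0.
  rewrite !term0 ?addr0 //.
    by case: i {em ec eb ea} ed => [|i] ed lei; [exact: cRm1_0 | exact: ed].
  case: i {ed ec eb ea} em => [|[|i]] em lei; last exact: em.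
    exact: cRm2_0.
  exact: cRm2_1.
move=> res0.
(* Below i = 2 two of the five indices coincide, and the coefficients of the
   repeated ones vanish. *)
pose s := [:: (cRm2 i, i.-2); (cRm1 i, i.-1); (cR0 i, i);
              (cRp1 i, i.+1); (cRp2 i, i.+2)].
have free j : (j <= top rho)%N -> \sum_(p <- s | p.2 == j) p.1 = 0.
  apply: R_free_seq => x lex; rewrite -[RHS](res0 x lex) /residue.
  by rewrite !big_cons big_nil /= addr0 !addrA.
have {}free j : (j <= top rho)%N -> 
    (i.-2 == j)%:R * cRm2 i + (i.-1 == j)%:R * cRm1 i + (i == j)%:R * cR0 i
    + (i.+1 == j)%:R * cRp1 i + (i.+2 == j)%:R * cRp2 i = 0.
  move=> lej; rewrite -[RHS](free j lej) !big_mkcond !big_cons big_nil /=.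
  by rewrite !addr0 !addrA; congr (_ + _ + _ + _ + _);
    case: eqP; rewrite ?mul1r ?mul0r.
have off (m n : nat) (a : F) : m <> n -> (m == n)%:R * a = 0.
  by move/eqP/negPf ->; rewrite mul0r.
have on (m : nat) (a : F) : (m == m)%:R * a = a by rewrite eqxx mul1r.
case: i {s res0} free => [|[|i]] free.
- split=> // lei; have := free _ lei;
    rewrite cRm2_0 // cRm1_0 // !mulr0 !add0r on !off ?addr0 ?add0r //; lia.
- split=> // [_|||] lei; have := free _ lei;
    rewrite cRm2_1 // mulr0 add0r on !off ?addr0 ?add0r //; lia.
split=> [_|_|||] lei; have := free _ lei;
  rewrite on !off ?addr0 ?add0r //; lia.
Qed.

Variable eta : int.
Hypothesis lam_mod : forall x : nat, (x <= top rho)%N ->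
  lam rho x%:Z = z * lam rhob (x%:Z + eta) - xi.

(** The contiguity relations up to i + 1 express the residue at i by the defect
    of the recurrence of rhob. *)
Lemma residue_contiguity (lm : int -> F) (i x : nat) :
  Pm 0 = 0 -> (x <= top rho)%N -> (i <= top rhob)%N ->
  (forall j, (j <= i.+1)%N -> (j <= top rhob)%N ->
     lm x%:Z * R rhob j (x%:Z + eta) = combination j x%:Z) ->
  residue i x%:Z =
    z * (lm x%:Z * (recurrence_defect rhob i).[lam rhob (x%:Z + eta)]).
Proof.
move=> Pm0 lex lei contig; rewrite residueE // -R_defect // lam_mod // subrK.
have comb_next : cA rhob i * combination i.+1 x%:Z =
    lm x%:Z * (cA rhob i * R rhob i.+1 (x%:Z + eta)).
  move: lei; rewrite leq_eqVlt => /predU1P[->|lti].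
    by rewrite cA_top !mul0r mulr0.
  by rewrite -contig // mulrCA.
have le_pi : (i.-1 <= i)%N by apply: leq_pred.
rewrite comb_next -(contig i) ?leqnSn // -(contig i.-1) ?(leqW le_pi) //.
  by ring.
exact: leq_trans lei.
Qed.

Lemma contiguity_combination0 (lm : int -> F) (x : nat) :
  contiguity rho rhob eta lm Pm P0 Pp -> (x <= top rho)%N ->
  lm x%:Z = combination 0 x%:Z.
Proof.
case=> _ _ _ contig lex; rewrite -[LHS]mulr1.
by rewrite /combination -contig // /R leq0n pol_0 hornerC.
Qed.

Lemma contiguity_R_system (lm : int -> F) (i : nat) :
  contiguity rho rhob eta lm Pm P0 Pp -> (i <= top rhob)%N -> R_system i.
Proof.
case=> Pm0 _ vanish contig lei; apply/residue_eq0 => // x lex.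
rewrite (residue_contiguity (lm := lm) Pm0 lex lei); last first.
  by move=> j _ lej; apply: contig.
move: lei; rewrite leq_eqVlt => /predU1P[->|lti]; last first.
  by rewrite recurrence_defect_eq0 // horner0 !mulr0.
have [|off] := boolP (lam rhob (x%:Z + eta) \in grid rhob).
  by rewrite -recurrence_defect_top => /eqP ->; rewrite !mulr0.
rewrite vanish ?mul0r ?mulr0 // => y ley.
by apply: contraNneq off => ->; apply/gridP; exists y.
Qed.

(** At i = top rhob only one coefficient of the residue has to be controlled: it
    is enough that the residue is some multiple delta of R_(top rho).  It then
    vanishes, since it does so at x0. *)
Lemma system_contiguity (lm : int -> F) (delta : F) (x0 : nat) :
  z != 0 -> (forall i, (i < top rhob)%N -> cA rhob i != 0) ->
  (forall i, (0 < i <= top rho)%N -> cC rho i != 0) ->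
  Pm 0 = 0 -> Pp 0 != 0 ->
  (forall x : nat, (x <= top rho)%N -> lm x%:Z = combination 0 x%:Z) ->
  (forall i, (i < top rhob)%N -> R_system i) ->
  (forall x : nat, (x <= top rho)%N ->
     residue (top rhob) x%:Z = delta * R rho (top rho) x%:Z) ->
  (x0 <= top rho)%N -> lam rhob (x0%:Z + eta) \in grid rhob ->
  contiguity rho rhob eta lm Pm P0 Pp.
Proof.
move=> nz nzAb nzC Pm0 Pp0 lm0 sys last_res lex0 on_grid.
have contig i x : (i <= top rhob)%N -> (x <= top rho)%N ->
    lm x%:Z * R rhob i (x%:Z + eta) = combination i x%:Z.
  move=> lei lex; have [n] := ubnP i; elim: n i lei => // n IHn [|i] lei lt_in.
    by rewrite /R leq0n pol_0 hornerC mulr1 lm0.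
  have IHi : lm x%:Z * R rhob i (x%:Z + eta) = combination i x%:Z.
    by apply: IHn; lia.
  have IHi1 : lm x%:Z * R rhob i.-1 (x%:Z + eta) = combination i.-1 x%:Z.
    by apply: IHn; lia.
  apply: (mulfI (mulf_neq0 nz (nzAb i lei))).
  have /residue_eq0 := sys i lei => /(_ Pm0 x lex).
  rewrite residueE // lam_mod // subrK -IHi -IHi1 => res0.
  have := R_defect (x%:Z + eta) (ltnW lei).
  rewrite recurrence_defect_eq0 // horner0 => Rb0.
  have algebra (a t y c l u u1 um s : F) :
      z * t * (l * u) - z * (a * s + y * (l * u) + c * (l * um)) = 0 ->
      t * u - (a * u1 + y * u + c * um) = 0 -> z * a * (l * u1) = z * a * s.
    move=> e1 e2; apply/subr0_eq.
    rewrite (_ : _ - _ = z * t * (l * u) - z * (a * s + y * (l * u)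
      + c * (l * um)) - z * l * (t * u - (a * u1 + y * u + c * um))); last ring.
    by rewrite e1 e2 mulr0 subrr.
  exact: algebra res0 Rb0.
have vanish x : (x <= top rho)%N ->
    z * (lm x%:Z * (recurrence_defect rhob (top rhob)).[lam rhob (x%:Z + eta)])
    = delta * R rho (top rho) x%:Z.
  move=> lex; rewrite -last_res //.
  rewrite (residue_contiguity (lm := lm) Pm0 lex (leqnn _)) //.
  by move=> j _ lej; apply: contig.
(* At x0 the recurrence of rhob holds, so that delta * R_(top rho) vanishes. *)
have delta0 : delta = 0.
  have := vanish x0 lex0; rewrite -recurrence_defect_top in on_grid.
  rewrite (eqP on_grid) !mulr0 => /esym/eqP; rewrite mulf_eq0.
  by rewrite (negPf (R_top_neq0 lex0 nzC)) orbF => /eqP.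
split=> // x lex off.
have /eqP := vanish x lex; rewrite delta0 mul0r !mulf_eq0 (negPf nz) /=.
rewrite recurrence_defect_top => /orP[/eqP //|/gridP[y ley ey]].
by have := off y ley; rewrite ey eqxx.
Qed.

End Coefficients.

(** * The explicit coefficients *)

Local Notation p := (PhiP_div_A rho rhob z).
Local Notation A := (cA rho).
Local Notation Ab := (cA rhob).
Local Notation C := (cC rho).
Local Notation Cb := (cC rhob).
Local Notation b := (bound rho rhob).
Local Notation m0 := (PhiM_div_C rho rhob z xi 0).

(** The sequence PhiM_div_C without its constant factor, normalized by
    weightM 0 = 1. *)
Definition weightM (i : nat) : F :=
  z ^+ i * \prod_(1 <= k < i.+1) (Cb k / C k).

(** The factors of PhiP_div_A and of PhiM_div_C / z in Phi0.  The
    numerators and denominators of C_B2 are combinations of their values at i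
    and i + 1, and of values of Y. *)
Definition slopeP (i : nat) : F :=
  (X rho i.+1 - z ^+ 2 * X rhob i) / E rho rhob z xi i.

Definition slopeM (i : nat) : F :=
  (X rho i - z ^+ 2 * X rhob i.+1) / E rho rhob z xi i.

Lemma slopePE (i : nat) :
  (z ^+ 2 * X rhob i - X rho i.+1) / D rho rhob z xi i = slopeP i.
Proof.
rewrite /slopeP -[LHS]mulrNN opprB -invrN; congr (_ / _).
by rewrite /D /E; ring.
Qed.

Lemma slopeME (i : nat) :
  (z ^+ 2 * X rhob i.+1 - X rho i) / D rho rhob z xi i = slopeM i.
Proof.
rewrite /slopeM -[LHS]mulrNN opprB -invrN; congr (_ / _).
by rewrite /D /E; ring.
Qed.

Lemma num1E (i : nat) : num1 rho rhob z xi i =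
  slopeM i - slopeM i.+1 + z * Y rhob i.+1 - Y rho i - xi.
Proof. by rewrite /num1 !slopeME. Qed.

Lemma num2E (i : nat) : num2 rho rhob z xi i =
  slopeM i - z ^+ 2 * X rhob i.+1 / X rho i.+1 * slopeM i.+1.
Proof. by rewrite /num2 !slopeME. Qed.

Lemma den1E (i : nat) : den1 rho rhob z xi i =
  X rho i.+1 / (z ^+ 2 * X rhob i.+1) * slopeP i.+1 - slopeP i.
Proof. by rewrite /den1 !slopePE. Qed.

Lemma den2E (i : nat) : den2 rho rhob z xi i =
  slopeP i.+1 - slopeP i + z * Y rhob i - Y rho i.+1 - xi.
Proof. by rewrite /den2 !slopePE. Qed.

Hypothesis Hgen : generic rho rhob z xi.

Let nz : z != 0 := gen_z Hgen.
Let nzA := gen_A Hgen.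
Let nzAb := gen_Ab Hgen.

Let nzC i : (i < top rho)%N -> C i.+1 != 0.
Proof. by move=> lti; apply: (gen_C Hgen). Qed.

Let nzCb i : (i < top rhob)%N -> Cb i.+1 != 0.
Proof. by move=> lti; apply: (gen_Cb Hgen). Qed.

Let nzA0 : A 0 != 0.
Proof. exact: nzA (gen_top Hgen). Qed.

Let nzAb0 : Ab 0 != 0.
Proof. exact: nzAb (gen_topb Hgen). Qed.

Lemma E_neq0 (i : nat) : (i <= b)%N -> E rho rhob z xi i != 0.
Proof.
move=> lei; rewrite -oppr_eq0 (_ : - _ = D rho rhob z xi i) ?(gen_D Hgen) //.
by rewrite /E /D; ring.
Qed.

Lemma bound_gt0 : (0 < b)%N.
Proof. by rewrite /bound leq_min (gen_top Hgen) (gen_topb Hgen). Qed.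

Lemma PhiP_div_A0 : p 0 = (A 0)^-1.
Proof. by rewrite /PhiP_div_A big_geq // expr0 invr1 mul1r mulr1. Qed.

Lemma PhiP_div_AS (i : nat) : (i < top rhob)%N -> z * Ab i * p i.+1 = A i * p i.
Proof.
move=> lti; rewrite /PhiP_div_A big_nat_recr //= exprS invfM.
by field; rewrite nzA0 expf_neq0 // nzAb.
Qed.

Lemma weightM0 : weightM 0 = 1.
Proof. by rewrite /weightM big_geq // expr0 mulr1. Qed.

Lemma weightMS (i : nat) : (i < top rho)%N ->
  C i.+1 * weightM i.+1 = z * Cb i.+1 * weightM i.
Proof.
move=> lti; rewrite /weightM big_nat_recr //= exprS.
by field; exact: nzC.
Qed.

Lemma PhiM_div_C_weightM (i : nat) :
  PhiM_div_C rho rhob z xi i = m0 * weightM i.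
Proof.
rewrite /PhiM_div_C /weightM (@big_geq _ _ _ 1 1) // expfzDr // -exprnP.
rewrite (_ : 0%:Z - 1 = -1) //; ring.
Qed.

Lemma PhiP_factor (i : nat) : (i < top rho)%N -> PhiP rho rhob z i = A i * p i.
Proof.
by move=> lti; rewrite PhiP_div_AE ?nzA ?(gen_top Hgen) // mulrC divfK ?nzA.
Qed.

Lemma PhiM_factor (i : nat) : (i < top rhob)%N ->
  PhiM rho rhob z xi i.+1 = Cb i.+1 * (m0 * weightM i).
Proof.
move=> lti; rewrite -PhiM_div_C_weightM PhiM_div_CE ?nzCb ?(gen_topb Hgen) //.
by rewrite mulrC divfK ?nzCb.
Qed.

Lemma Phi0_factor (i : nat) : Phi0 rho rhob z xi i =
  slopeP i * p i + slopeM i / z * (m0 * weightM i).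
Proof.
rewrite /Phi0 -PhiM_div_C_weightM; congr (_ + _ * _).
by rewrite /slopeM invfM mulrA [RHS]mulrAC.
Qed.

Lemma PhiP_div_A_neq0 (i : nat) : (i <= b)%N -> p i != 0.
Proof.
rewrite leq_min; elim: i => [|i IHi] /andP[ltN ltM].
  by rewrite PhiP_div_A0 invr_eq0 nzA ?(gen_top Hgen).
have : A i * p i != 0 by rewrite mulf_neq0 ?nzA ?IHi ?(ltnW ltN) ?(ltnW ltM).
by rewrite -PhiP_div_AS // !mulf_eq0 !negb_or => /andP[].
Qed.

Lemma weightM_neq0 (i : nat) : (i <= b)%N -> weightM i != 0.
Proof.
rewrite leq_min; elim: i => [|i IHi] /andP[ltN ltM].
  by rewrite weightM0 oner_eq0.
have {}IHi : weightM i != 0 by rewrite IHi ?(ltnW ltN) ?(ltnW ltM).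
have := mulf_neq0 (mulf_neq0 nz (nzCb ltM)) IHi.
by rewrite -weightMS // !mulf_eq0 !negb_or => /andP[].
Qed.

(** The product in C_B2, with its power of z, is the ratio of weightM and
    PhiP_div_A, the two sequences that carry Phi^-1 and Phi^1. *)
Lemma prod_X_ratio (i : nat) : (i <= b)%N ->
  z ^+ (2 * i) * \prod_(1 <= k < i.+1) (X rhob k / X rho k) * p i =
  p 0 * weightM i.
Proof.
rewrite leq_min; elim: i => [|i IHi] /andP[ltN ltM].
  by rewrite big_geq // muln0 expr0 weightM0 !mul1r mulr1.
have {}IHi := IHi (introT andP (conj (ltnW ltN) (ltnW ltM))).
rewrite big_nat_recr //= mulnS exprD.
have algebra (Ai Abi Ci Cbi zz P pi pi1 w w1 p0 : F) :
    Ai != 0 -> Ci != 0 -> z * Abi * pi1 = Ai * pi -> Ci * w1 = z * Cbi * w ->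
    zz * P * pi = p0 * w ->
    z ^+ 2 * zz * (P * (Abi * Cbi / (Ai * Ci))) * pi1 = p0 * w1.
  move=> nzAi nzCi ep ew epw; apply: (mulfI nzCi).
  rewrite [RHS]mulrCA ew (_ : _ * (z * Cbi * w) = z * Cbi * (p0 * w)); last ring.
  rewrite -epw (_ : pi = z * Abi * pi1 / Ai); last by rewrite ep mulrC mulKf.
  by field; rewrite nzAi.
exact: algebra (nzA ltN) (nzC ltN) (PhiP_div_AS ltM) (weightMS ltN) IHi.
Qed.


(** * The scalar recurrences for coefficients of the explicit form *)

Section Shape.

Variables (Pm P0 Pp : nat -> F) (c mu : F).

(** Coefficients Phi^1, Phi^-1 and Phi^0 of the explicit form, with a global
    factor c and an arbitrary constant mu in place of PhiM_div_C 0. *)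
Definition shapeP : Prop := forall i, (i < top rho)%N -> (i <= top rhob)%N ->
  Pp i = c * (A i * p i).

Definition shapeM : Prop := Pm 0%N = 0 /\ forall i, (i < top rhob)%N ->
  Pm i.+1 = c * (Cb i.+1 * (mu * weightM i)).

Definition shape0 (i : nat) : F :=
  c * (slopeP i * p i + slopeM i / z * (mu * weightM i)).

Lemma cR0_shape (i : nat) : shapeP -> shapeM -> (i <= b)%N ->
  cR0 Pm P0 Pp i = E rho rhob z xi i * (shape0 i - P0 i).
Proof.
move=> hP [hM0 hM]; rewrite leq_min => /andP[leN leM].
have nzE : E rho rhob z xi i != 0 by apply: E_neq0; rewrite leq_min leN.
have t1 : Pp i * cCt rho i.+1 = c * (X rho i.+1 * p i).
  rewrite /cCt /=; case: ltngtP leN => // [ltN _|-> _].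
    by rewrite hP //; ring.
  by rewrite cA_top !mul0r !mulr0.
have t2 : Pm i * A i.-1 = c * (X rho i / z * (mu * weightM i)).
  case: i leN leM {nzE t1} => [|i] ltN ltM; first by rewrite hM0 !mul0r mulr0.
  rewrite hM //=.
  transitivity (c * mu * A i / z * (C i.+1 * weightM i.+1)); last by ring.
  by rewrite weightMS //; field.
have t3 : z * Ab i * Pm i.+1 = c * (z * X rhob i.+1 * (mu * weightM i)).
  move: leM; rewrite leq_eqVlt => /predU1P[->|ltM]; last by rewrite hM //=; ring.
  by rewrite /= cA_top; ring.
have t4 : z * Cb i * Pp i.-1 = c * (z ^+ 2 * X rhob i * p i).
  case: i leN leM {nzE t1 t2 t3} => [|i] ltN ltM.
    by rewrite cC_0 /=; ring.
  by rewrite hP ?(ltnW ltM) //= -PhiP_div_AS //; ring.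
rewrite /cR0 t1 t2 t3 t4 mulrBr; congr (_ - _).
by rewrite /shape0 /slopeP /slopeM; field; rewrite nz.
Qed.

Lemma cRp1_shape (i : nat) : shapeP -> (i < b)%N ->
  P0 i = shape0 i -> P0 i.+1 = shape0 i.+1 ->
  cRp1 P0 Pp i =
  c * A i / z * (num2 rho rhob z xi i * (mu * weightM i)
                 - den2 rho rhob z xi i * (z * p i)).
Proof.
move=> hP; rewrite leq_min => /andP[ltN ltM] h0 h1.
rewrite /cRp1 h0 h1 hP ?(ltnW ltM) // num2E den2E /shape0.
have algebra (Ai Abi Ci Cbi pi pi1 w w1 y yb u u1 v v1 : F) :
    Ai != 0 -> Ci != 0 -> z * Abi * pi1 = Ai * pi -> Ci * w1 = z * Cbi * w ->
    c * (u * pi + v / z * (mu * w)) * Ai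
      - z * Abi * (c * (u1 * pi1 + v1 / z * (mu * w1)))
      - (z * yb - y - xi) * (c * (Ai * pi)) =
    c * Ai / z * ((v - z ^+ 2 * (Abi * Cbi) / (Ai * Ci) * v1) * (mu * w)
      - (u1 - u + z * yb - y - xi) * (z * pi)).
  move=> nzAi nzCi ep ew.
  have -> : z * Abi * (c * (u1 * pi1 + v1 / z * (mu * w1))) =
    c * u1 * (z * Abi * pi1) + c * Abi * v1 * mu / Ci * (Ci * w1).
    by field; rewrite nzCi.
  by rewrite ep ew; field; rewrite nz nzAi nzCi.
exact: algebra (nzA ltN) (nzC ltN) (PhiP_div_AS ltM) (weightMS ltN).
Qed.

Lemma cRm1_shape (i : nat) : shapeM -> (i < b)%N ->
  P0 i = shape0 i -> P0 i.+1 = shape0 i.+1 ->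
  cRm1 Pm P0 i.+1 =
  c * Cb i.+1 * (den1 rho rhob z xi i * (z * p i)
                 - num1 rho rhob z xi i * (mu * weightM i)).
Proof.
move=> [_ hM]; rewrite leq_min => /andP[ltN ltM] h0 h1.
rewrite /cRm1 /= h0 h1 hM // num1E den1E /shape0 /cCt ltN.
have algebra (Ai Abi Ci Cbi pi pi1 w w1 y yb u u1 v v1 : F) :
    Ai != 0 -> Abi != 0 -> Ci != 0 -> Cbi != 0 ->
    z * Abi * pi1 = Ai * pi -> Ci * w1 = z * Cbi * w ->
    c * (u1 * pi1 + v1 / z * (mu * w1)) * Ci
      - z * Cbi * (c * (u * pi + v / z * (mu * w)))
      - (z * yb - y - xi) * (c * (Cbi * (mu * w))) =
    c * Cbi * ((Ai * Ci / (z ^+ 2 * (Abi * Cbi)) * u1 - u) * (z * pi)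
      - (v - v1 + z * yb - y - xi) * (mu * w)).
  move=> nzAi nzAbi nzCi nzCbi ep ew.
  have -> : c * (u1 * pi1 + v1 / z * (mu * w1)) * Ci =
    c * u1 * Ci / (z * Abi) * (z * Abi * pi1) + c * v1 / z * mu * (Ci * w1).
    by field; rewrite nz nzAbi.
  by rewrite ep ew; field; rewrite nz nzAbi nzCbi.
exact: algebra (nzA ltN) (nzAb ltM) (nzC ltN) (nzCb ltM)
  (PhiP_div_AS ltM) (weightMS ltN).
Qed.

Lemma cRp2_shape (i : nat) : shapeP -> (i.+1 < top rho)%N ->
  (i < top rhob)%N -> cRp2 Pp i = 0.
Proof.
move=> hP ltN ltM; rewrite /cRp2 !hP ?(ltnW ltN) ?(ltnW ltM) //.
rewrite (_ : z * _ * _ = c * A i.+1 * (z * Ab i * p i.+1)); last by ring.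
by rewrite PhiP_div_AS //; ring.
Qed.

Lemma cRm2_shape (i : nat) : shapeM -> (i < top rho)%N ->
  (i.+1 < top rhob)%N -> cRm2 Pm i.+2 = 0.
Proof.
move=> [_ hM] ltN ltM; rewrite /cRm2 /= !hM ?(ltnW ltM) // /cCt ltN.
rewrite (_ : _ * C i.+1 = c * Cb i.+2 * mu * (C i.+1 * weightM i.+1)).
  by rewrite weightMS //; ring.
by ring.
Qed.

End Shape.

(** * The constraint C_B2 *)

Lemma num2_0 :
  num2 rho rhob z xi 0 = - (z ^+ 2 * X rhob 1 * denB rho rhob z xi).
Proof.
have nzE0 := E_neq0 (leq0n b); have nzE1 := E_neq0 bound_gt0.
rewrite num2E /slopeM /denB [X rho 0]/= [X rho 1]/= [X rhob 1]/=.
by field; rewrite nzE0 nzE1 nzA0 nzC ?(gen_top Hgen).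
Qed.

Lemma den2_0 : den2 rho rhob z xi 0 = - numB rho rhob z xi.
Proof. by rewrite den2E /slopeP /numB [X rhob 0]/= mulr0 subr0; ring. Qed.

(** PhiM_div_C 0 solves the second equation of [ratio_eq] at i = 0. *)
Lemma PhiM_div_C0 :
  num2 rho rhob z xi 0 * m0 = den2 rho rhob z xi 0 * (z * p 0).
Proof.
have nzCb1 : Cb 1 != 0 by apply: nzCb (gen_topb Hgen).
have nzB := gen_denB Hgen.
rewrite num2_0 den2_0 PhiP_div_A0 /PhiM_div_C big_geq //.
rewrite (_ : z ^ (0%:Z - 1) = z^-1) // [X rhob 1]/=.
by field; rewrite nzAb0 nzB nz nzCb1 nzA0.
Qed.

Lemma num2_0_neq0 : num2 rho rhob z xi 0 != 0.
Proof.
have nzCb1 : Cb 1 != 0 by apply: nzCb (gen_topb Hgen).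
by rewrite num2_0 oppr_eq0 !mulf_neq0 ?expf_neq0 //; apply: gen_denB Hgen.
Qed.

(** The two equations obtained from the coefficients of R_(i-1) and R_(i+1). *)
Definition ratio_eq (mu : F) (i : nat) : Prop :=
  num1 rho rhob z xi i * (mu * weightM i) = den1 rho rhob z xi i * (z * p i) /\
  num2 rho rhob z xi i * (mu * weightM i) = den2 rho rhob z xi i * (z * p i).

Lemma ratio_eq0 (mu : F) : ratio_eq mu 0 -> mu = m0.
Proof.
case=> _; rewrite weightM0 mulr1 -PhiM_div_C0 => e.
exact: mulfI num2_0_neq0 _ _ e.
Qed.

(** The constant in C_B2 is z * PhiP_div_A 0 / PhiM_div_C 0. *)
Lemma C_B2_ratio : C_B2 rho rhob z xi <-> forall i, (i < b)%N -> ratio_eq m0 i.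
Proof.
have p0_neq0 : p 0 != 0 by apply: PhiP_div_A_neq0.
have algebra (i : nat) (n d K : F) : (i < b)%N -> d != 0 -> K * m0 = z * p 0 ->
    m0 != 0 ->
    (z ^+ (2 * i) * (n / d) * \prod_(1 <= k < i.+1) (X rhob k / X rho k) = K
     <-> n * (m0 * weightM i) = d * (z * p i)).
  move=> lti nzd eK nzm; have := prod_X_ratio (ltnW lti).
  have := PhiP_div_A_neq0 (ltnW lti).
  have := weightM_neq0 (ltnW lti).
  set P := \prod_(_ <= _ < _) _; move: (weightM i) (p i) (p 0) p0_neq0 eK.
  move=> w pi p0 nzp0 eK nzw nzpi ratio.
  split=> [e | e].
    apply: (mulfI nzp0).
    rewrite (_ : p0 * (n * (m0 * w)) = n * m0 * (p0 * w)); last by ring.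
    rewrite -ratio (_ : p0 * (d * (z * pi)) = d * pi * (z * p0)); last by ring.
    by rewrite -eK -e; field.
  apply: (mulIf nzm); rewrite eK; apply: (mulIf nzpi).
  rewrite (_ : _ * m0 * pi = n * m0 / d * (z ^+ (2 * i) * P * pi)); last by field.
  rewrite ratio (_ : _ * (p0 * w) = p0 / d * (n * (m0 * w))); last by field.
  by rewrite e; field.
split=> [[K hK] i lti | ratio].
  (* From expr2 0 = K and PhiM_div_C0; as p 0 != 0, it shows that m0 != 0. *)
  have nzd := gen_den2 Hgen bound_gt0.
  have eK : K * m0 = z * p 0.
    apply: (mulfI nzd); rewrite -PhiM_div_C0 -(hK 0%N bound_gt0).2 /Defs.expr2.
    by rewrite big_geq // muln0 expr0; field.
  have nzm : m0 != 0.
    apply: contra_neq p0_neq0 => m00; apply: (mulfI nz).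
    by rewrite -eK m00 !mulr0.
  have [e1 e2] := hK i lti; split.
    by apply/(algebra _ _ _ K) => //; apply: gen_den1 Hgen _ _.
  by apply/(algebra _ _ _ K) => //; apply: gen_den2 Hgen _ _.
have nzm : m0 != 0.
  have [e _] := ratio 0%N bound_gt0; apply: contra_neq p0_neq0 => m00.
  apply: (mulfI (mulf_neq0 (gen_den1 Hgen bound_gt0) nz)).
  by rewrite -mulrA -e m00 !(mul0r, mulr0).
exists (z * p 0 / m0) => i lti; have [e1 e2] := ratio i lti.
have eK : z * p 0 / m0 * m0 = z * p 0 by rewrite divfK.
split.
  by apply/(algebra _ _ _ _ lti _ eK nzm) => //; apply: gen_den1 Hgen _ _.
by apply/(algebra _ _ _ _ lti _ eK nzm) => //; apply: gen_den2 Hgen _ _.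
Qed.

Lemma lamM_combination (x : nat) : (x <= top rho)%N ->
  lamM rho rhob z xi x%:Z =
  Phi0 rho rhob z xi 0 + PhiP rho rhob z 0 * R rho 1 x%:Z.
Proof.
move=> lex; have := R_recurrence 0 lex.
have nzE0 := E_neq0 (leq0n b); have nzE1 := E_neq0 bound_gt0.
have nzC1 : C 1 != 0 by apply: nzC (gen_top Hgen).
have nzCb1 : Cb 1 != 0 by apply: nzCb (gen_topb Hgen).
have nzB := gen_denB Hgen.
rewrite /R leq0n (gen_top Hgen) /= pol_0 hornerC mulr1 /Y cC_0 cCt_0 !addr0 mul0r.
rewrite mulr1 addr0 => lamE.
have PhiP0 : PhiP rho rhob z 0 = 1 by rewrite /PhiP big_geq // expr0 invr1 mulr1.
have R1 : (pol rho 1).[lam rho x] = 1 + lam rho x / A 0.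
  apply: (mulfI nzA0); rewrite [RHS](_ : _ = lam rho x + A 0); last by field.
  by rewrite [in RHS]lamE subrK.
have eE : A 0 - z * Ab 0 - xi = E rho rhob z xi 0.
  by rewrite /E /Y !cC_0; ring.
(* The last denominator of lamM. *)
have last_den : E rho rhob z xi 0 * (X rho 1 - z ^+ 2 * X rhob 2)
    / (C 1 * E rho rhob z xi 1) + A 0 =
    A 0 * E rho rhob z xi 0 * denB rho rhob z xi.
  rewrite /denB [X rho 1]/=; field.
  by rewrite nzE0 nzE1 nzA0 nzC1.
have m0E : m0 =
    numB rho rhob z xi / (z * Ab 0 * A 0 * denB rho rhob z xi * Cb 1).
  rewrite /PhiM_div_C big_geq // (_ : z ^ (0%:Z - 1) = z^-1) //.
  by field; rewrite nzAb0 nzB nz nzCb1 nzA0.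
rewrite /lamM eE last_den PhiP0 mul1r R1 Phi0_factor weightM0 mulr1 m0E.
rewrite PhiP_div_A0 /slopeP /slopeM [X rho 0]/= [X rhob 0]/= [X rho 1]/=.
rewrite [X rhob 1]/=.
by field; rewrite nzAb0 nzB nz nzCb1 nzA0 nzE0.
Qed.

(** * The equivalence *)

Section Equivalence.

Variables (Pm P0 Pp : nat -> F).
Variable eta : int.
Hypothesis Hmod : modification rho rhob z xi eta.

Let leNM : (top rho <= (top rhob).+1)%N.
Proof. by case: Hmod => _ _ []. Qed.

Let leMN : (top rhob <= (top rho).+1)%N.
Proof. by case: Hmod => _ _ []. Qed.

Let lam_mod (x : nat) : (x <= top rho)%N ->
  lam rho x%:Z = z * lam rhob (x%:Z + eta) - xi.
Proof. by case: Hmod => _ + _; apply. Qed.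

(** Some grid point of rho is shifted into the grid of rhob. *)
Lemma grid_shift : exists2 x : nat, (x <= top rho)%N &
  lam rhob (x%:Z + eta) \in grid rhob.
Proof.
have [/[!inE] /or3P[]/eqP-> _ _] := Hmod.
- by exists 0%N => //; apply/gridP; exists 0%N.
- by exists 0%N => //; apply/gridP; exists 1%N => //; apply: gen_topb Hgen.
- by exists 1%N; [apply: gen_top Hgen | apply/gridP; exists 0%N].
Qed.

Lemma R_system_shape : Pm 0%N = 0 -> Pp 0%N != 0 ->
  (forall i, (i <= top rhob)%N -> R_system Pm P0 Pp i) ->
  [/\ shapeP Pp (Pp 0), shapeM Pm (Pp 0) m0,
      forall i, (i <= b)%N -> P0 i = shape0 (Pp 0) m0 i
    & C_B2 rho rhob z xi].
Proof.
move=> Pm0 Pp0 sys; set c := Pp 0%N; have nzc : c != 0 by [].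
have hP : shapeP Pp c.
  elim=> [|i IHi] ltN ltM; first by rewrite PhiP_div_A0 mulfV // mulr1.
  have [_ _ _ _ /(_ ltN)/subr0_eq] := sys i (ltnW ltM).
  rewrite IHi ?(ltnW ltN) ?(ltnW ltM) // => e.
  apply: (mulfI (mulf_neq0 nz (nzAb ltM))); rewrite -e.
  rewrite (_ : c * (A i * p i) * A i.+1 = c * A i.+1 * (A i * p i)); last by ring.
  by rewrite -PhiP_div_AS //; ring.
pose mu := Pm 1%N / Cb 1%N / c.
have hM : shapeM Pm c mu.
  split=> //; elim=> [|i IHi] ltM.
    by rewrite weightM0 mulr1 /mu; field; rewrite Pp0 nzCb.
  have ltN : (i < top rho)%N by rewrite -ltnS; apply: leq_trans ltM leMN.
  have [/(_ isT (ltnW ltN))/subr0_eq + _ _ _ _] := sys i.+2 ltM.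
  rewrite /cCt /= ltN IHi ?(ltnW ltM) // => e.
  apply: (mulIf (nzC ltN)); rewrite e.
  rewrite (_ : _ * C i.+1 = c * Cb i.+2 * mu * (C i.+1 * weightM i.+1)).
    by rewrite weightMS //; ring.
  by ring.
have h0 i : (i <= b)%N -> P0 i = shape0 c mu i.
  move=> lei; have := lei; rewrite leq_min => /andP[leN leM].
  have [_ _ /(_ leN) + _ _] := sys i leM.
  rewrite (cR0_shape _ hP hM lei) => /eqP; rewrite mulf_eq0.
  by rewrite (negPf (E_neq0 lei)) => /eqP/subr0_eq.
have ratio i : (i < b)%N -> ratio_eq mu i.
  move=> lti; have := lti; rewrite leq_min => /andP[ltN ltM].
  have [_ _ _ /(_ ltN) + _] := sys i (ltnW ltM).
  rewrite (cRp1_shape hP lti (h0 _ (ltnW lti)) (h0 _ lti)) => /eqP.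
  rewrite !mulf_eq0 invr_eq0 (negPf nzc) (negPf (nzA ltN)) (negPf nz) /=.
  move=> /eqP/subr0_eq e2.
  have [_ /(_ isT (ltnW ltN)) + _ _ _] := sys i.+1 ltM.
  rewrite (cRm1_shape hM lti (h0 _ (ltnW lti)) (h0 _ lti)) => /eqP.
  by rewrite !mulf_eq0 (negPf nzc) (negPf (nzCb ltM)) => /eqP/subr0_eq.
have mu_m0 : mu = m0 by apply/ratio_eq0/ratio/bound_gt0.
by rewrite -mu_m0; split=> //; apply/C_B2_ratio; rewrite -mu_m0.
Qed.

(** At i = top rhob, the coefficient of R_(top rho) in the residue is left
    undetermined when the two tops differ. *)
Lemma shape_R_system (c : F) :
  shapeP Pp c -> shapeM Pm c m0 ->
  (forall i, (i <= b)%N -> P0 i = shape0 c m0 i) -> C_B2 rho rhob z xi ->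
  (forall i, (i < top rhob)%N -> R_system Pm P0 Pp i) /\
  exists delta, forall x : nat, (x <= top rho)%N ->
    residue Pm P0 Pp (top rhob) x%:Z = delta * R rho (top rho) x%:Z.
Proof.
move=> hP hM h0 /C_B2_ratio ratio; have Pm0 := hM.1.
have em0 i : (i <= top rhob)%N -> cRm2 Pm i = 0.
  case: i => [_|[_|i lti]]; [exact: cRm2_0 | exact: cRm2_1 |].
  by apply: (cRm2_shape hM) => //; rewrite -ltnS; apply: leq_trans lti leMN.
have ed0 i : (i <= b)%N -> cRm1 Pm P0 i = 0.
  case: i => [_|i lti]; first exact: cRm1_0.
  rewrite (cRm1_shape hM lti (h0 _ (ltnW lti)) (h0 _ lti)).
  by have [-> _] := ratio i lti; rewrite subrr mulr0.
have ec0 i : (i <= b)%N -> cR0 Pm P0 Pp i = 0.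
  by move=> lei; rewrite (cR0_shape _ hP hM lei) h0 // subrr mulr0.
have eb0 i : (i < b)%N -> cRp1 P0 Pp i = 0.
  move=> lti; rewrite (cRp1_shape hP lti (h0 _ (ltnW lti)) (h0 _ lti)).
  by have [_ ->] := ratio i lti; rewrite subrr mulr0.
split=> [i lti|].
  have lei : (i <= b)%N.
    by rewrite leq_min (ltnW lti) andbT -ltnS; apply: leq_trans lti leMN.
  split=> [_ _|_ _|_|ltN|ltN].
  - exact/em0/ltnW.
  - exact: ed0.
  - exact: ec0.
  - by apply: eb0; rewrite leq_min ltN.
  - exact: (cRp2_shape hP).
have R_gt j x : (top rho < j)%N -> R rho j x = 0 by rewrite /R ltnNge => /negPf->.
have res_top x : residue Pm P0 Pp (top rhob) x =
    cRm1 Pm P0 (top rhob) * R rho (top rhob).-1 x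
    + cRp1 P0 Pp (top rhob) * R rho (top rhob).+1 x.
  rewrite /residue em0 // mul0r add0r [R _ _.+2 _]R_gt // mulr0 addr0.
  have [leMN'|ltNM] := leqP (top rhob) (top rho).
    by rewrite ec0 ?leq_min ?leMN' ?leqnn // mul0r addr0.
  by rewrite [R _ (top rhob) _]R_gt // mulr0 addr0.
have [ltMN|ltNM|eMN] := ltngtP (top rhob) (top rho).
(* If top rho = top rhob + 1, the coefficient of R_(i+1) remains; if
   top rhob = top rho + 1, that of R_(i-1). *)
- have eN : top rho = (top rhob).+1 by apply/eqP; rewrite eqn_leq ltMN leNM.
  exists (cRp1 P0 Pp (top rhob)) => x lex; rewrite res_top ed0.
    by rewrite eN mul0r add0r.
  by rewrite leq_min leqnn ltnW.
- have eM : top rhob = (top rho).+1 by apply/eqP; rewrite eqn_leq ltNM leMN.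
  exists (cRm1 Pm P0 (top rhob)) => x lex; rewrite res_top [R _ _.+1 _]R_gt.
    by rewrite mulr0 addr0 eM.
  exact: ltnW.
exists 0 => x lex; rewrite res_top ed0 ?[R _ _.+1 _]R_gt ?eMN //; first by ring.
by rewrite leq_min eMN leqnn.
Qed.

Lemma explicit_shape (lm : int -> F) :
  explicit_coefficients rho rhob z xi lm Pm P0 Pp <->
  exists2 c : F, c != 0 &
    [/\ forall x : nat, (x <= top rho)%N ->
          lm x%:Z = c * lamM rho rhob z xi x%:Z,
        shapeP Pp c, shapeM Pm c m0 &
        forall i, (i <= b)%N -> P0 i = shape0 c m0 i].
Proof.
split=> -[c nzc [hlam hP hM h0]]; exists c => //; split=> //.
- by move=> i ltN leM; rewrite hP // PhiP_factor.
- split=> [|i ltM]; first by rewrite hM // mulr0.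
  by rewrite hM ?PhiM_factor // -ltnS; apply: leq_trans ltM leMN.
- by move=> i; rewrite leq_min => /andP[leN leM]; rewrite h0 // Phi0_factor.
- by move=> i leM ltN; rewrite hP // PhiP_factor.
- have [hM0 hMS] := hM.
  by case=> [|i] leM _; rewrite ?hM0 ?mulr0 // hMS // PhiM_factor.
- by move=> i leM leN; rewrite h0 ?leq_min ?leN // /shape0 Phi0_factor.
Qed.

Lemma combination0_shape (c : F) (x : nat) : Pm 0%N = 0 ->
  shapeP Pp c -> P0 0%N = shape0 c m0 0 -> (x <= top rho)%N ->
  combination Pm P0 Pp 0 x%:Z = c * lamM rho rhob z xi x%:Z.
Proof.
move=> Pm0 hP h0 lex; rewrite lamM_combination // Phi0_factor.
rewrite PhiP_factor ?(gen_top Hgen) // /combination Pm0 h0 hP ?(gen_top Hgen) //.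
by rewrite {1 2}/R leq0n pol_0 hornerC /shape0; ring.
Qed.

Lemma contiguity_explicit (lm : int -> F) :
  contiguity rho rhob eta lm Pm P0 Pp <->
  explicit_coefficients rho rhob z xi lm Pm P0 Pp /\ C_B2 rho rhob z xi.
Proof.
split=> [contig | [/explicit_shape[c nzc [hlam hP hM h0]] hB]].
  have [Pm0 Pp0 _ _] := contig.
  have sys i (leM : (i <= top rhob)%N) := contiguity_R_system lam_mod contig leM.
  have [hP hM h0 hB] := R_system_shape Pm0 Pp0 sys.
  split=> //; apply/explicit_shape; exists (Pp 0%N) => //; split=> // x lex.
  rewrite (contiguity_combination0 contig lex).
  exact: combination0_shape (h0 _ (leq0n b)) lex.
have [sys [delta res_top]] := shape_R_system hP hM h0 hB.
have [x0 lex0 grid_x0] := grid_shift.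
apply: (system_contiguity lam_mod nz nzAb (gen_C Hgen) hM.1 _ _ sys res_top lex0
  grid_x0) => [|x lex].
  by rewrite hP ?(gen_top Hgen) // PhiP_div_A0 mulfV // mulr1.
by rewrite hlam // (combination0_shape hM.1 hP (h0 _ (leq0n b))).
Qed.

End Equivalence.
End TwoFamilies.

Unset Implicit Arguments.

Theorem proposition2p6 (F : fieldType) (rho rhob : finite_family F)
    (z xi : F) (eta : int)
    (Hmod : modification rho rhob z xi eta)
    (Hgen : generic rho rhob z xi) :
  ((exists (lm : int -> F) (Pm P0 Pp : nat -> F),
      contiguity rho rhob eta lm Pm P0 Pp) <->
   C_B2 rho rhob z xi)
  /\
  (forall (lm : int -> F) (Pm P0 Pp : nat -> F),
     contiguity rho rhob eta lm Pm P0 Pp <->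
     explicit_coefficients rho rhob z xi lm Pm P0 Pp /\ C_B2 rho rhob z xi).
Proof.
have main lm Pm P0 Pp := contiguity_explicit Hgen Pm P0 Pp Hmod lm.
split=> //; split=> [[lm [Pm [P0 [Pp /main[]]]]] // | hB].
exists (lamM rho rhob z xi), (PhiM rho rhob z xi), (Phi0 rho rhob z xi),
  (PhiP rho rhob z); apply/main; split=> //.
by exists 1; [exact: oner_neq0 | split=> *; rewrite mul1r].
Qed.
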